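(* As vector spaces, $\mathbb{H}_k(r,n)\simeq S(V_0)\otimes\mathbb{C}G$; that is, the linear map $S(V_0)\otimes\mathbb{C}G\to\mathbb{H}_k(r,n)$ sending $p(e_1,\dots,e_n)\otimes g$ to $p(e_1,\dots,e_n)\,t_g$ is an isomorphism of vector spaces.
   Context: Let $r,n\ge 1$ be integers, $\xi\in\mathbb{C}$ a primitive $r$-th root of unity, $\bar k_0\in\mathbb{C}$. Let $V_0$ be a hermitian space with orthonormal basis $e_1,\dots,e_n$. $S_n$ acts on $V_0$ by $w(e_i)=e_{w(i)}$; $(u,v)$ denotes a transposition. $\theta_i\in U(V_0)$ is the diagonal map with $\theta_i(e_i)=\xi e_i$, $\theta_i(e_j)=e_j$ for $j\ne i$; $T\simeq(\mathbb{Z}/r\mathbb{Z})^n$ is the group generated by the $\theta_i$, and $G=T\rtimes S_n\subset U(V_0)$ (the complex reflection group $G(r,1,n)$). For $u\ne v$ put $\tilde k_{u,v}=\frac{\bar k_0}{2}\sum_{m=0}^{r-1}(\theta_u^m\theta_v^{-m}+\theta_v^m\theta_u^{-m})\in\mathbb{C}T$. $\mathbb{H}_k(r,n)$ is the unital associative $\mathbb{C}$-algebra generated by $e_1,\dots,e_n$ and $t_g$ ($g\in G$), with relations: $e_ie_j=e_je_i$; $t_gt_h=t_{gh}$ ($t_1=1$); $t_{\theta_i}e_j=e_jt_{\theta_i}$ for all $i,j$; $t_{(j,j+1)}e_i=e_it_{(j,j+1)}$ for $i\ne j,j+1$; $t_{(i,i+1)}e_i=e_{i+1}t_{(i,i+1)}-\tilde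 k_{i,i+1}$ for $1\le i\le n-1$ (with $\tilde k_{i,i+1}\in\mathbb{C}T$ viewed in the algebra via $g\mapsto t_g$). $S(V_0)$ is the symmetric algebra of $V_0$, i.e. the polynomial algebra in $e_1,\dots,e_n$. *)

(* Defs.v *)
From HB Require Import structures.
From mathcomp Require Import all_boot all_order all_fingroup all_algebra.
From mathcomp Require Import generic_quotient ring_quotient spectral.
From mathcomp Require Import finmap boolp classical_sets reals.
From mathcomp Require Import complex.
From mathcomp Require Import monalg mpoly.

Set Implicit Arguments.
Unset Strict Implicit.
Unset Printing Implicit Defensive.

Import Order.TTheory GRing.Theory Num.Theory.

Local Open Scope ring_scope.
Local Open Scope classical_set_scope.

(* -------------------------------------------------------------------- *)
Section Submodule.
Variables (K : pzRingType) (V : lmodType K).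

Definition is_submodule (S : set V) : Prop :=
  [/\ S 0, forall u v, S u -> S v -> S (u + v) & forall a u, S u -> S (a *: u)].

Definition submodule_span (X : set V) : set V := smallest is_submodule X.

Lemma submodule_spanP (X : set V) : is_submodule (submodule_span X).
Proof.
split=> [S [[]] //|u v Xu Xv S XS|a u Xu S XS].
  by have [[_ + _] _] := XS; apply; [exact: Xu | exact: Xv].
by have [[_ _ +] _] := XS; apply; exact: Xu.
Qed.

End Submodule.

(* -------------------------------------------------------------------- *)
Section LmodQuotient.
Variables (K : pzRingType) (V : lmodType K) (S : set V) (HS : is_submodule S).

Definition submodule_pred & is_submodule S : V -> bool := fun x => `[< S x >].

Local Notation SP := (submodule_pred HS).

Lemma submodule_pred_closed : zmod_closed SP.
Proof.
have [S0 SD SZ] := HS; split; first exact/asboolP.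
move=> u v /asboolP Su /asboolP Sv; apply/asboolP; rewrite -scaleN1r.
by apply: SD => //; exact: SZ.
Qed.

HB.instance Definition _ := GRing.isZmodClosed.Build V SP submodule_pred_closed.

Definition submodule_zmod : zmodClosed V := GRing.ZmodClosed.clone V SP _.

Definition lmod_quot : Type := {ideal_quot submodule_zmod}.

HB.instance Definition _ := GRing.Zmodule.on lmod_quot.

Local Notation Q := lmod_quot.
Local Notation piQ := (\pi_{ideal_quot submodule_zmod}%qT : V -> Q).

Definition lmod_pi (x : V) : Q := piQ x.

Lemma lmod_piP x y : lmod_pi x = lmod_pi y <-> S (x - y).
Proof.
by split=> [/eqP|/asboolP Sxy]; [|apply/eqP];
  rewrite -Quotient.idealrBE // => /asboolP.
Qed.

Lemma lmod_pi_surj (q : Q) : exists x, lmod_pi x = q.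
Proof. by exists (repr (q : {ideal_quot submodule_zmod})); exact: reprK. Qed.

Lemma lmod_pi_is_additive : zmod_morphism lmod_pi.
Proof. by move=> x y; rewrite /lmod_pi [LHS]raddfB. Qed.

HB.instance Definition _ :=
  GRing.isZmodMorphism.Build V Q lmod_pi lmod_pi_is_additive.

Definition quot_scale (a : K) (q : Q) : Q :=
  lmod_pi (a *: repr (q : {ideal_quot submodule_zmod})).

Lemma quot_scaleE a x : quot_scale a (lmod_pi x) = lmod_pi (a *: x).
Proof.
apply/lmod_piP; rewrite -scalerBr; have [_ _] := HS; apply; apply/lmod_piP.
exact: reprK.
Qed.

Lemma quot_scalerA a b q :
  quot_scale a (quot_scale b q) = quot_scale (a * b) q.
Proof. by have [x <-] := lmod_pi_surj q; rewrite !quot_scaleE scalerA. Qed.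

Lemma quot_scale1r : left_id 1 quot_scale.
Proof.
by move=> q; have [x <-] := lmod_pi_surj q; rewrite quot_scaleE scale1r.
Qed.

Lemma quot_scalerDr : right_distributive quot_scale +%R.
Proof.
move=> a q q'; have [x <-] := lmod_pi_surj q; have [y <-] := lmod_pi_surj q'.
by rewrite -raddfD !quot_scaleE -raddfD scalerDr.
Qed.

Lemma quot_scalerDl q : {morph quot_scale^~ q : a b / a + b}.
Proof.
move=> a b; have [x <-] := lmod_pi_surj q.
by rewrite !quot_scaleE -raddfD scalerDl.
Qed.

HB.instance Definition _ := GRing.Zmodule_isLmodule.Build K Q
  quot_scalerA quot_scale1r quot_scalerDr quot_scalerDl.

Lemma lmod_pi_is_scalable : scalable lmod_pi.
Proof. by move=> a x; rewrite -quot_scaleE. Qed.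

HB.instance Definition _ :=
  GRing.isScalable.Build K V Q *:%R lmod_pi lmod_pi_is_scalable.

End LmodQuotient.

(* -------------------------------------------------------------------- *)
Section Tensor.
Variables (K : comNzRingType) (U W : lmodType K).

Local Notation pure u w := (<< (u, w) >> : {malg K[(U * W)%type]}).

(* tensor is the free K-module on U * W modulo bilinearity. *)
Inductive tensor_rel : {malg K[(U * W)%type]} -> Prop :=
| TensorDl u u' w : tensor_rel (pure (u + u') w - (pure u w + pure u' w))
| TensorDr u w w' : tensor_rel (pure u (w + w') - (pure u w + pure u w'))
| TensorZl a u w : tensor_rel (pure (a *: u) w - a *: pure u w)
| TensorZr a u w : tensor_rel (pure u (a *: w) - a *: pure u w).

Definition tensor : Type := lmod_quot (submodule_spanP tensor_rel).

HB.instance Definition _ := GRing.Lmodule.on tensor.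

Definition tens (u : U) (w : W) : tensor := lmod_pi (submodule_spanP tensor_rel) (pure u w).

End Tensor.

(* -------------------------------------------------------------------- *)
Definition free_alg (K : nzRingType) (X : choiceType) := {malg K[{fmonom X}]}.

Definition free_gen (K : nzRingType) (X : choiceType) (x : X) : free_alg K X :=
  << fmu x >>.

Section PresentedAlgebra.
Variables (K : comNzRingType) (X : choiceType).

HB.instance Definition _ := GRing.Lalgebra.on (free_alg K X).

Local Notation F := (free_alg K X).

Lemma free_alg_scalerAr (a : K) (x y : F) : a *: (x * y) = x * (a *: y).
Proof.
have xC : x * (<< a *g (@monalg.one (fmonom X)) >> : {malg K[{fmonom X}]}) = a *: x.
  rewrite malgM_def malgZ_def fgmulgU; apply: eq_bigr => k _.
  by rewrite monalg.mulm1 mulrC.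
by rewrite scalerAl -xC -mulrA mul_malgC.
Qed.

Definition is_ideal (S : set F) : Prop :=
  [/\ is_submodule S, forall a x, S x -> S (a * x) & forall a x, S x -> S (x * a)].

Variable rel : set F.

Definition ideal_span : set F := smallest is_ideal rel.

Lemma ideal_spanP : is_ideal ideal_span.
Proof.
split; [split=> [|u v Su Sv|a u Su] | move=> a u Su | move=> a u Su].
- by move=> S [[[]]].
- move=> S IS; have [[[_ + _] _ _] _] := IS.
  by apply; [exact: Su | exact: Sv].
- by move=> S IS; have [[[_ _ +] _ _] _] := IS; apply; exact: Su.
- by move=> S IS; have [[_ + _] _] := IS; apply; exact: Su.
- by move=> S IS; have [[_ _ +] _] := IS; apply; exact: Su.
Qed.

Lemma ideal_submodule : is_submodule ideal_span.
Proof. by have [] := ideal_spanP. Qed.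

Definition presented_alg : Type := lmod_quot ideal_submodule.

HB.instance Definition _ := GRing.Lmodule.on presented_alg.

Local Notation A := presented_alg.

Definition presented_pi : F -> A := @lmod_pi K F ideal_span ideal_submodule.

HB.instance Definition _ := GRing.Linear.copy presented_pi (@lmod_pi K F ideal_span ideal_submodule).

Lemma presented_piP x y : presented_pi x = presented_pi y <-> ideal_span (x - y).
Proof. exact: lmod_piP. Qed.

Lemma presented_pi_surj q : exists x, presented_pi x = q.
Proof. exact: lmod_pi_surj. Qed.

Definition presented_mul (p q : A) : A :=
  presented_pi (repr (p : {ideal_quot submodule_zmod ideal_submodule}) * repr (q : {ideal_quot submodule_zmod ideal_submodule})).

Lemma presented_mulE x y :
  presented_mul (presented_pi x) (presented_pi y) = presented_pi (x * y).
Proof.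
have [[_ SD _] Sl Sr] := ideal_spanP.
apply/presented_piP; set x' := repr _; set y' := repr _.
have xE : ideal_span (x' - x) by apply/presented_piP; exact: reprK.
have yE : ideal_span (y' - y) by apply/presented_piP; exact: reprK.
have -> : x' * y' - x * y = x' * (y' - y) + (x' - x) * y.
  by rewrite mulrBr mulrBl addrA subrK.
by apply: SD; [exact: Sl | exact: Sr].
Qed.

Lemma presented_mulA : associative presented_mul.
Proof.
move=> p q s; have [x <-] := presented_pi_surj p.
have [y <-] := presented_pi_surj q; have [z <-] := presented_pi_surj s.
by rewrite !presented_mulE mulrA.
Qed.

Lemma presented_mul1l : left_id (presented_pi 1) presented_mul.
Proof.
by move=> p; have [x <-] := presented_pi_surj p; rewrite presented_mulE mul1r.
Qed.

Lemma presented_mul1r : right_id (presented_pi 1) presented_mul.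
Proof.
by move=> p; have [x <-] := presented_pi_surj p; rewrite presented_mulE mulr1.
Qed.

Lemma presented_mulDl : left_distributive presented_mul +%R.
Proof.
move=> p q s; have [x <-] := presented_pi_surj p.
have [y <-] := presented_pi_surj q; have [z <-] := presented_pi_surj s.
by rewrite -raddfD !presented_mulE -raddfD mulrDl.
Qed.

Lemma presented_mulDr : right_distributive presented_mul +%R.
Proof.
move=> p q s; have [x <-] := presented_pi_surj p.
have [y <-] := presented_pi_surj q; have [z <-] := presented_pi_surj s.
by rewrite -raddfD !presented_mulE -raddfD mulrDr.
Qed.

(* Only a pzRingType: whether 1 != 0 depends on the relations, so that the
   library's algType cannot be used here. *)
HB.instance Definition _ := GRing.Zmodule_isPzRing.Build A
  presented_mulA presented_mul1l presented_mul1r presented_mulDl presented_mulDr.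

Lemma presented_pi_is_monoid_morphism : monoid_morphism presented_pi.
Proof. by split=> // x y; rewrite -presented_mulE. Qed.

HB.instance Definition _ := GRing.isMonoidMorphism.Build F A presented_pi
  presented_pi_is_monoid_morphism.

Lemma presented_scalerAl (a : K) (p q : A) : a *: (p * q) = (a *: p) * q.
Proof.
have [x <-] := presented_pi_surj p; have [y <-] := presented_pi_surj q.
by rewrite -rmorphM -!linearZ -rmorphM scalerAl.
Qed.

Lemma presented_scalerAr (a : K) (p q : A) : a *: (p * q) = p * (a *: q).
Proof.
have [x <-] := presented_pi_surj p; have [y <-] := presented_pi_surj q.
by rewrite -rmorphM -!linearZ -rmorphM free_alg_scalerAr.
Qed.

End PresentedAlgebra.

(* -------------------------------------------------------------------- *)
Section UnitaryGroup.
Variables (C : numClosedFieldType) (n : nat).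

Record unitary := Unitary {
  unitary_mx :> 'M[C]_n;
  unitary_mxP : unitary_mx \is unitarymx
}.

HB.instance Definition _ := [isSub for unitary_mx].
HB.instance Definition _ := [Choice of unitary by <:].

Lemma unitary1_subproof : (1%:M : 'M[C]_n) \is unitarymx.
Proof. by apply/unitarymxP; rewrite trmx1 map_mx1 mulmx1. Qed.

Lemma unitaryV_subproof (A : unitary) : invmx A \is unitarymx.
Proof.
by rewrite invmx_unitary ?trmxC_unitary; apply: unitary_mxP.
Qed.

Definition unitary1 := Unitary unitary1_subproof.
Definition unitary_mul (A B : unitary) :=
  Unitary (mul_unitarymx (unitary_mxP A) (unitary_mxP B)).
Definition unitary_inv (A : unitary) := Unitary (unitaryV_subproof A).

Lemma unitary_mulA : associative unitary_mul.
Proof. by move=> A B D; apply/val_inj; rewrite /= mulmxA. Qed.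

Lemma unitary_mul1g : left_id unitary1 unitary_mul.
Proof. by move=> A; apply/val_inj; rewrite /= mul1mx. Qed.

Lemma unitary_mulg1 : right_id unitary1 unitary_mul.
Proof. by move=> A; apply/val_inj; rewrite /= mulmx1. Qed.

Lemma unitary_mulVg : left_inverse unitary1 unitary_inv unitary_mul.
Proof.
by move=> A; apply/val_inj; rewrite /= mulVmx ?unitarymx_unit ?unitary_mxP.
Qed.

Lemma unitary_mulgV : right_inverse unitary1 unitary_inv unitary_mul.
Proof.
by move=> A; apply/val_inj; rewrite /= mulmxV ?unitarymx_unit ?unitary_mxP.
Qed.

HB.instance Definition _ := isGroup.Build unitary
  unitary_mulA unitary_mul1g unitary_mulg1 unitary_mulVg unitary_mulgV.

End UnitaryGroup.

Definition is_subgroup (gT : groupType) (S : set gT) : Prop :=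
  [/\ S 1%g, forall x y, S x -> S y -> S (x * y)%g & forall x, S x -> S x^-1%g].

Definition subgroup_span (gT : groupType) (X : set gT) : set gT :=
  smallest (@is_subgroup gT) X.

Lemma subgroup_spanP (gT : groupType) (X : set gT) : is_subgroup (subgroup_span X).
Proof.
split=> [S [[]] //|x y Xx Xy S XS|x Xx S XS].
  by have [[_ + _] _] := XS; apply; [exact: Xx | exact: Xy].
by have [[_ _ +] _] := XS; apply; exact: Xx.
Qed.

(* -------------------------------------------------------------------- *)
(* V_0 is the standard hermitian space of column vectors, e_i being the i-th
   column delta_mx i 0, so that operators are matrices acting on the left. *)
Section ReflectionGroup.
Variables (C : numClosedFieldType) (r n : nat) (xi : C).
Hypothesis xiP : r.-primitive_root xi.

Definition theta_mx (i : 'I_n) : 'M[C]_n :=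
  diag_mx (\row_j (if j == i then xi else 1)).

(* e_j |-> e_(w j). Products of 'S_n compose from left to right, hence the
   order in UpermM below. *)
Definition wperm_mx (w : 'S_n) : 'M[C]_n := \matrix_(i, j) (i == w j)%:R.

Lemma theta_unitary i : theta_mx i \is unitarymx.
Proof.
have xi1 : xi * xi^* = 1.
  have r0 : (0 < r)%N := prim_order_gt0 xiP.
  rewrite -normCK -[RHS](expr1n _ 2); congr (_ ^+ 2).
  apply/eqP; rewrite -(@pexpr_eq1 _ _ r) // -normrX.
  by rewrite (prim_expr_order xiP) normr1.
apply/unitarymxP; rewrite tr_diag_mx map_diag_mx mulmx_diag -diag_const_mx.
congr diag_mx; apply/rowP => j; rewrite !mxE.
by case: eqP => // _; rewrite rmorph1 mulr1.
Qed.

Lemma wperm_mxE w : wperm_mx w = (perm_mx w)^T.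
Proof. by apply/matrixP => i j; rewrite !mxE eq_sym. Qed.

Lemma wperm_unitary w : wperm_mx w \is unitarymx.
Proof.
apply/unitarymxP; rewrite wperm_mxE trmxK map_perm_mx tr_perm_mx -perm_mxM.
by rewrite mulVg perm_mx1.
Qed.

Definition Utheta (i : 'I_n) : unitary C n := Unitary (theta_unitary i).
Definition Uperm (w : 'S_n) : unitary C n := Unitary (wperm_unitary w).

Definition torus : set (unitary C n) := subgroup_span (range Utheta).

(* G(r,1,n) as the internal semidirect product T S_n in U(V_0). *)
Definition refl_group : set (unitary C n) :=
  [set g | exists t w, torus t /\ g = (t * Uperm w)%g].

Lemma UpermM s w : (Uperm s * Uperm w = Uperm (w * s))%g.
Proof.
by apply/val_inj; rewrite /= !wperm_mxE -trmx_mul -perm_mxM.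
Qed.

Lemma Uperm1 : Uperm 1 = 1%g.
Proof. by apply/val_inj; rewrite /= wperm_mxE perm_mx1 trmx1. Qed.

Lemma UpermV w : (Uperm w)^-1%g = Uperm w^-1%g.
Proof. by apply: mulg1_eq; rewrite UpermM mulVg Uperm1. Qed.

Lemma Uperm_theta w i : (Uperm w * Utheta i = Utheta (w i) * Uperm w)%g.
Proof.
apply/val_inj; rewrite /= mul_diag_mx mul_mx_diag; apply/matrixP => j k.
by rewrite !mxE; have [->|] := eqVneq j (w k);
  rewrite ?(inj_eq perm_inj) ?mul1r ?mulr1 ?mul0r ?mulr0.
Qed.

Lemma torus_conj w t : torus t -> torus (Uperm w * t * (Uperm w)^-1)%g.
Proof.
have [T1 TM TV] := subgroup_spanP (range Utheta).
move=> Tt; pose S := [set t | torus (Uperm w * t * (Uperm w)^-1)%g].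
have: S t; last by [].
apply: Tt; split; first split.
- by rewrite /S /= mulg1 mulgV.
- move=> x y Sx Sy; rewrite /S /=.
  have -> : (Uperm w * (x * y) * (Uperm w)^-1 =
    Uperm w * x * (Uperm w)^-1 * (Uperm w * y * (Uperm w)^-1))%g.
    by rewrite !mulgA mulgVK.
  exact: TM.
- move=> x Sx; rewrite /S /=.
  have -> : (Uperm w * x^-1 * (Uperm w)^-1 =
    (Uperm w * x * (Uperm w)^-1)^-1)%g by rewrite !invgM invgK mulgA.
  exact: TV.
- move=> _ [i _ <-]; rewrite /S /= Uperm_theta mulgK => B [_]; apply.
  by exists (w i).
Qed.

Lemma refl_group_subgroup : is_subgroup refl_group.
Proof.
have [T1 TM TV] := subgroup_spanP (range Utheta).
split=> [|_ _ [t [w [Tt ->]]] [t' [w' [Tt' ->]]]|_ [t [w [Tt ->]]]].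
- by exists 1%g, 1%g; rewrite Uperm1 mulg1.
- exists (t * (Uperm w * t' * (Uperm w)^-1))%g, (w' * w)%g; split.
    by apply: TM => //; exact: torus_conj.
  by rewrite -UpermM !mulgA mulgVK.
- exists (Uperm w^-1 * t^-1 * (Uperm w^-1)^-1)%g, w^-1%g; split.
    by apply: torus_conj; exact: TV.
  by rewrite mulgVK invgM UpermV.
Qed.

Record reflgrp := Reflgrp {
  reflgrp_val :> unitary C n;
  reflgrpP : `[< refl_group reflgrp_val >]
}.

HB.instance Definition _ := [isSub for reflgrp_val].
HB.instance Definition _ := [Choice of reflgrp by <:].

Lemma refl_group_closed : group_closed (fun g => `[< refl_group g >]).
Proof.
have [G1 GM GV] := refl_group_subgroup; split; first exact/asboolP.
by move=> g h /asboolP Gg /asboolP Gh; apply/asboolP/GM => //; exact: GV.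
Qed.

HB.instance Definition _ :=
  SubChoice_isSubGroup.Build (unitary C n) _ reflgrp refl_group_closed.

Lemma theta_subproof i : `[< refl_group (Utheta i) >].
Proof.
apply/asboolP; exists (Utheta i), 1%g; rewrite Uperm1 mulg1; split=> //.
by move=> S [_]; apply; exists i.
Qed.

Lemma wperm_subproof w : `[< refl_group (Uperm w) >].
Proof.
apply/asboolP; exists 1%g, w; rewrite mul1g; split=> //.
by have [] := subgroup_spanP (range Utheta).
Qed.

Definition theta (i : 'I_n) : reflgrp := Reflgrp (theta_subproof i).
Definition wperm (w : 'S_n) : reflgrp := Reflgrp (wperm_subproof w).

End ReflectionGroup.

(* -------------------------------------------------------------------- *)
Section HeckeAlgebra.
Variables (C : numClosedFieldType) (r n : nat) (xi : C).
Variables (xiP : r.-primitive_root xi) (k0 : C).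

Local Notation G := (reflgrp n xiP).
Local Notation F := (free_alg C ('I_n + G)%type).

Definition group_alg := {malg C[G]}.

Definition group_gen (g : G) : group_alg := << g >>.

HB.instance Definition _ := GRing.Lmodule.on group_alg.

Definition ktilde (u v : 'I_n) : group_alg :=
  (k0 / 2%:R) *: \sum_(m < r)
    (group_gen (theta xiP u ^+ m * theta xiP v ^- m)%g +
     group_gen (theta xiP v ^+ m * theta xiP u ^- m)%g).

Definition Fe (i : 'I_n) : F := free_gen C (inl i).
Definition Ft (g : G) : F := free_gen C (inr g).

(* The image of an element of C[G] under g |-> t_g, extended linearly. *)
Definition Ft_lin (x : group_alg) : F :=
  \sum_(g <- monalg.msupp x) monalg.mcoeff g x *: Ft g.

Definition Fs (i j : 'I_n) : F := Ft (wperm xiP (tperm i j)).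

(* Each element r of hecke_rel is a defining relation r = 0; indices are
   0-based and the simple transpositions are the (i, i') with i' = i + 1. *)
Inductive hecke_rel : F -> Prop :=
| rel_comm i j : hecke_rel (Fe i * Fe j - Fe j * Fe i)
| rel_group g h : hecke_rel (Ft g * Ft h - Ft (g * h)%g)
| rel_one : hecke_rel (Ft 1%g - 1)
| rel_theta i j :
    hecke_rel (Ft (theta xiP i) * Fe j - Fe j * Ft (theta xiP i))
| rel_far (i j j' : 'I_n) : j' = j.+1 :> nat -> i != j -> i != j' ->
    hecke_rel (Fs j j' * Fe i - Fe i * Fs j j')
| rel_adj (i i' : 'I_n) : i' = i.+1 :> nat ->
    hecke_rel (Fs i i' * Fe i - (Fe i' * Fs i i' - Ft_lin (ktilde i i'))).

Definition hecke : Type := presented_alg hecke_rel.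

HB.instance Definition _ := GRing.PzRing.on hecke.
HB.instance Definition _ := GRing.Lmodule.on hecke.

Definition hecke_e (i : 'I_n) : hecke := presented_pi hecke_rel (Fe i).
Definition hecke_t (g : G) : hecke := presented_pi hecke_rel (Ft g).

(* S(V_0) is mpoly n C, and this is p |-> p(e_1, ..., e_n); it does not depend
   on the order of the factors since the e_i commute in hecke. *)
Definition hecke_poly (p : mpoly n C) : hecke :=
  \sum_(m <- mpoly.msupp p) mpoly.mcoeff m p *: \prod_(i < n) hecke_e i ^+ m i.

End HeckeAlgebra.

(* Main.v *)
Require Import Defs.
From HB Require Import structures.
From mathcomp Require Import all_boot all_order all_fingroup all_algebra.
From mathcomp Require Import generic_quotient ring_quotient spectral.
From mathcomp Require Import finmap boolp classical_sets.
From mathcomp Require Import reals complex monalg mpoly.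
From mathcomp Require Import zify.

(** The theorem says that the elements e^m t_g, for m a multi-index and g in
    G = G(r,1,n), form a basis of the algebra H.  (Below, e^m is [hecke_mono m],
    and an element g of G permutes the lines spanned by the basis vectors, hence
    the indices, through [perm_part g].)

    They span: by induction on a product of generators for g, the element
    t_g e_i has the form e_j t_g plus a combination of the t_h ([hecke_te]).  So
    the span of the e^m t_g is stable under right multiplication by all
    generators, and it contains 1 ([pbw_map_surj]).

    They are independent because H acts on the right on the vector space M with
    basis the symbols [g; m], in such a way that [1; 0] e^m t_g = [g; m]
    ([hecke_rep], [hecke_repK]).  The action of t_h is [g; m] t_h = [gh; m].
    That of e_i is found as follows.  Let s_ij be the transposition and
    R_ij = k_ij s_ij, where k_ij is the element called ktilde, so that R_ij is
    k0 times the sum over 0 <= a < r of the reflections theta_i^a theta_j^-a s_ij.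
    Conjugation by g maps R_ij to R_(gi)(gj).  If J_i is the Jucys-Murphy sum of
    the R_ij with j < i, the relations say exactly that z_i = e_i - J_i is
    equivariant, t_g z_i = z_(gi) t_g.  Therefore
      t_g e_i = e_(gi) t_g + t_g J_i - J_(gi) t_g
              = e_(gi) t_g + t_g sum_j ([j < i] - [gj < gi]) R_ij,
    and this formula defines the operator of e_i on M ([act_e]).

    All relations but the commutation of the e_i are then short computations on
    basis vectors ([act_e_theta], [act_e_adj]).  The operators of e_i and e_j
    commute on the vectors [1; m], where there is no correction term.  The
    relations already proved show that the commutator of e_i and e_j can be
    moved across t_theta and across t_s, for s a simple transposition, where it
    becomes the commutator of e_(si) and e_(sj); the terms in ktilde cancel
    ([jump_balance]).  As these elements generate G, the commutators vanish on
    all of M ([act_eC]).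

    Finally the tensor product is spanned by the X^m (x) g, which are the images
    of the [g; m] under a map M -> S(V_0) (x) C[G] whose composite with the map
    of the theorem is [g; m] |-> e^m t_g.  The former is surjective and the
    composite is bijective, so the map of the theorem is bijective. *)

Set Implicit Arguments.
Unset Strict Implicit.
Unset Printing Implicit Defensive.

Import Order.TTheory GRing.Theory Num.Theory.

Local Open Scope ring_scope.

(** * Linear maps out of free modules, quotients and tensor products *)

Lemma linear_map0 (K : pzRingType) (U V : lmodType K) (f : U -> V) :
  linear f -> f 0 = 0.
Proof. by move=> /(_ (-1) 0 0); rewrite scaler0 addr0 scaleN1r addNr. Qed.

(** Both finitely supported functions and polynomials are expanded as sums over
    a support that depends on the vector; linearity holds because such a sum may
    be taken over any larger duplicate-free index list. *)
Section SupportedSum.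
Variables (K : nzRingType) (I : eqType) (U V : lmodType K).
Variables (supp : U -> seq I) (coef : I -> U -> K) (phi : I -> V).
Hypothesis supp_uniq : forall u, uniq (supp u).
Hypothesis coef_supp : forall u i, i \notin supp u -> coef i u = 0.
Hypothesis coefP : forall a i u v,
  coef i (a *: u + v) = a * coef i u + coef i v.

Lemma supported_sum_widen u s : uniq s -> {subset supp u <= s} ->
  \sum_(i <- supp u) coef i u *: phi i = \sum_(i <- s) coef i u *: phi i.
Proof.
move=> s_uniq sub; rewrite [RHS](bigID (mem (supp u))) /=.
rewrite [X in _ = _ + X]big1 ?addr0.
  rewrite -[RHS]big_filter; apply: perm_big; apply: uniq_perm => //.
    by rewrite filter_uniq.
  by move=> i; rewrite mem_filter; case: (boolP (i \in supp u)) => // /sub ->.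
by move=> i /coef_supp ->; rewrite scale0r.
Qed.

Lemma supported_sum_linear :
  linear (fun u => \sum_(i <- supp u) coef i u *: phi i).
Proof.
move=> a u v; pose s := undup (supp (a *: u + v) ++ supp u ++ supp v).
have widen w : {subset supp w <= supp (a *: u + v) ++ supp u ++ supp v} ->
    \sum_(i <- supp w) coef i w *: phi i = \sum_(i <- s) coef i w *: phi i.
  move=> sub; apply: supported_sum_widen; first exact: undup_uniq.
  by move=> i /sub; rewrite mem_undup.
rewrite !widen; try by move=> i iw; rewrite !mem_cat iw ?orbT.
rewrite scaler_sumr -big_split; apply: eq_bigr => i _ /=.
by rewrite coefP scalerDl scalerA.
Qed.
End SupportedSum.

(** Locked, since unification would otherwise compare the underlying functions
    when it has to tell two linear maps apart. *)
HB.lock Definition malg_lin (K : nzRingType) (B : choiceType) (V : lmodType K)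
    (phi : B -> V) (x : {malg K[B]}) : V :=
  \sum_(b <- monalg.msupp x) monalg.mcoeff b x *: phi b.

Section MalgLin.
Variables (K : nzRingType) (B : choiceType) (V : lmodType K).

Lemma malg_lin_is_linear (phi : B -> V) : linear (malg_lin phi).
Proof.
rewrite malg_lin.unlock; apply: supported_sum_linear => [u|u i|a i u v].
- exact: fset_uniq.
- exact: mcoeff_outdom.
- by rewrite monalg.mcoeffD monalg.mcoeffZ.
Qed.

HB.instance Definition _ (phi : B -> V) :=
  GRing.isLinear.Build K {malg K[B]} V *:%R (malg_lin phi)
    (malg_lin_is_linear phi).

Lemma malg_linU (phi : B -> V) b : malg_lin phi << b >> = phi b.
Proof.
by rewrite malg_lin.unlock msuppU oner_eq0 big_seq_fset1 mcoeffUU scale1r.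
Qed.

Lemma malgU_scale (c : K) (b : B) : << c *g b >> = c *: << b >> :> {malg K[B]}.
Proof.
apply/malgP => k; rewrite monalg.mcoeffZ !mcoeffU.
by case: eqP; rewrite ?mulr1 ?mulr0.
Qed.

Lemma malg_ind (P : {malg K[B]} -> Prop) :
    (forall b, P << b >>) ->
    (forall a x y, P x -> P y -> P (a *: x + y)) -> P 0 ->
  forall x, P x.
Proof.
move=> PU PD P0 x; rewrite [x]monalgE.
elim/big_rec: _ => // b y _ Py.
by rewrite malgU_scale; exact: PD.
Qed.

Lemma linear_malg_ext (f g : {linear {malg K[B]} -> V}) :
  (forall b, f << b >> = g << b >>) -> f =1 g.
Proof.
move=> fg; apply: malg_ind => [//|a x y fx fy|]; last by rewrite !linear0.
by rewrite !linearP fx fy.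
Qed.
End MalgLin.

Lemma lmod_quot_lift (K : pzRingType) (V W : lmodType K) (S : set V)
    (HS : is_submodule S) (f : {linear V -> W}) :
  (forall x, S x -> f x = 0) ->
  exists g : {linear lmod_quot HS -> W}, forall x, g (lmod_pi HS x) = f x.
Proof.
move=> fS; pose g (q : lmod_quot HS) : W :=
  f (repr (q : {ideal_quot submodule_zmod HS})).
have gE x : g (lmod_pi HS x) = f x.
  apply/eqP; rewrite -subr_eq0 -raddfB; apply/eqP/fS/(lmod_piP HS).
  exact: reprK.
have g_lin : linear g.
  move=> a p q; have [x <-] := lmod_pi_surj p; have [y <-] := lmod_pi_surj q.
  by rewrite -linearP !gE linearP.
pose gL := GRing.isLinear.Build K (lmod_quot HS) W *:%R g g_lin.
pose gl : {linear lmod_quot HS -> W} := HB.pack g gL.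
by exists gl.
Qed.

Lemma ker_submodule (K : pzRingType) (V W : lmodType K) (f : {linear V -> W}) :
  is_submodule (fun x => f x = 0).
Proof.
split=> [|u v fu fv|a u fu]; first exact: linear0.
- by rewrite linearD fu fv addr0.
- by rewrite linearZ_LR fu scaler0.
Qed.

Section TensorLift.
Variables (K : comNzRingType) (U W V : lmodType K) (B : U -> W -> V).
Hypothesis Bl : forall w, linear (B^~ w).
Hypothesis Br : forall u, linear (B u).

Let linD (X : lmodType K) (h : X -> V) : linear h ->
  {morph h : u v / u + v} /\ forall a, {morph h : u / a *: u}.
Proof.
move=> lin_h; have hD : {morph h : u v / u + v}.
  by move=> u v; rewrite -[u]scale1r lin_h !scale1r.
split=> // a u.
by rewrite -[a *: u]addr0 lin_h (linear_map0 lin_h) addr0.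
Qed.

Lemma tensor_lift_subproof x : submodule_span (@tensor_rel K U W) x ->
  malg_lin (fun uw : U * W => B uw.1 uw.2) x = 0.
Proof.
move=> Sx; apply: (Sx (fun x => malg_lin _ x = 0)).
split; first exact: ker_submodule.
move=> _ [u u' w|u w w'|a u w|a u w] /=;
  rewrite ?(linearB, linearD, linearZ_LR) /= !malg_linU /=.
- by have [-> _] := linD (Bl w); rewrite -opprD subrr.
- by have [-> _] := linD (Br u); rewrite -opprD subrr.
- by have [_ ->] := linD (Bl w); rewrite scalerN subrr.
- by have [_ ->] := linD (Br u); rewrite scalerN subrr.
Qed.

Lemma tensor_lift :
  exists g : {linear tensor U W -> V}, forall u w, g (tens u w) = B u w.
Proof.
have [g gE] := lmod_quot_lift (submodule_spanP _) tensor_lift_subproof.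
by exists g => u w; rewrite /tens gE /= malg_linU.
Qed.
End TensorLift.

Section TensTheory.
Variables (K : comNzRingType) (U W : lmodType K).

Lemma tens_linearl (w : W) : linear (fun u : U => tens u w).
Proof.
move=> a u u'; rewrite /tens -linearP; apply/lmod_piP.
have [_ SD _] := submodule_spanP (@tensor_rel K U W).
(* Pass through the intermediate element given by additivity alone. *)
rewrite -[_ - _](subrKA (<< (a *: u, w) >> + << (u', w) >>)).
rewrite [a *: << _ >> + _]addrC addrKA.
by apply: SD => S [_]; apply; [exact: TensorDl | exact: TensorZl].
Qed.

Lemma tens_linearr (u : U) : linear (fun w : W => tens u w).
Proof.
move=> a w w'; rewrite /tens -linearP; apply/lmod_piP.
have [_ SD _] := submodule_spanP (@tensor_rel K U W).
rewrite -[_ - _](subrKA (<< (u, a *: w) >> + << (u, w') >>)).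
rewrite [a *: << _ >> + _]addrC addrKA.
by apply: SD => S [_]; apply; [exact: TensorDr | exact: TensorZr].
Qed.

Lemma tensor_ind (P : tensor U W -> Prop) :
    (forall u w, P (tens u w)) ->
    (forall a x y, P x -> P y -> P (a *: x + y)) -> P 0 ->
  forall x, P x.
Proof.
move=> PT PD P0 x; have [y <-] := lmod_pi_surj x.
elim/malg_ind: y => [[u w]|a y z Py Pz|]; first exact: PT.
  by rewrite linearP; exact: PD.
by rewrite linear0.
Qed.
End TensTheory.

(** * Right modules over a presented algebra *)

Section FreeAlgAction.
Variables (K : comNzRingType) (X : choiceType) (V : lmodType K).
Variable op : X -> {linear V -> V}.

(** The letters of a word act from left to right, so that words act on the
    right; see [free_actM]. *)
Definition word_act (w : seq X) (v : V) : V := foldl (fun v y => op y v) v w.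

Definition free_act (v : V) : {linear free_alg K X -> V} :=
  malg_lin (fun w : {fmonom X} => word_act w v).

Lemma word_act_is_linear w : linear (word_act w).
Proof.
elim: w => [|y w IHw] a u v //.
rewrite -[LHS]/(word_act w (op y (a *: u + v))).
by rewrite linearP IHw.
Qed.

Lemma free_act_linear x : linear (free_act^~ x).
Proof.
move=> a u v; rewrite /free_act /= malg_lin.unlock scaler_sumr -big_split /=.
by apply: eq_bigr => w _; rewrite word_act_is_linear scalerDr !scalerA mulrC.
Qed.

Lemma free_act0 x : free_act 0 x = 0.
Proof. exact: linear_map0 (free_act_linear x). Qed.

Lemma free_act_gen y v : free_act v (free_gen K y) = op y v.
Proof. by rewrite /free_act /= malg_linU fmU. Qed.

Lemma free_act1 v : free_act v 1 = v.
Proof. by rewrite /free_act /= malg_linU fm1. Qed.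

Lemma free_actM v x y : free_act v (x * y) = free_act (free_act v x) y.
Proof.
elim/malg_ind: y => [w|a y z IHy IHz|]; last by rewrite mulr0 !linear0.
  elim/malg_ind: x => [w'|a x x' IHx IHx'|].
  - rewrite malgM_def fgmulUU mulr1 /= !malg_linU.
    by rewrite fmM /word_act foldl_cat.
  - rewrite mulrDl -scalerAl !(linearP (free_act v)) free_act_linear.
    by congr (_ *: _ + _).
  - by rewrite mul0r !linear0 free_act0.
rewrite mulrDr -free_alg_scalerAr (linearP (free_act v)) linearP.
by congr (_ *: _ + _).
Qed.

(** The elements that act as zero on the whole module form a two-sided ideal. *)
Lemma free_act_ideal (rel : set (free_alg K X)) :
    (forall x, rel x -> forall v, free_act v x = 0) ->
  forall x, ideal_span rel x -> forall v, free_act v x = 0.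
Proof.
move=> act_rel x Ix; apply: (Ix (fun x => forall v, free_act v x = 0)).
split=> //; split=> [|a y ay v|a y ay v].
- split=> [v|u w uv wv v|a u uv v]; first exact: linear0.
    by rewrite linearD uv wv addr0.
  by rewrite linearZ_LR uv scaler0.
- by rewrite free_actM ay.
- by rewrite free_actM ay free_act0.
Qed.

(** The orbit map of v: a representation of the presented algebra is used only
    through the images of one vector. *)
Lemma presented_act (rel : set (free_alg K X)) :
    (forall x, rel x -> forall v, free_act v x = 0) ->
  forall v, exists g : {linear presented_alg rel -> V},
    forall x, g (presented_pi rel x) = free_act v x.
Proof.
move=> act_rel v; apply: lmod_quot_lift => x Ix.
exact: free_act_ideal Ix v.
Qed.
End FreeAlgAction.

(** Products are extended on the right, as suits subspaces that are stable under
    right multiplication. *)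
Lemma free_alg_ind (K : comNzRingType) (X : choiceType)
    (P : free_alg K X -> Prop) :
    P 0 -> P 1 -> (forall a x y, P x -> P y -> P (a *: x + y)) ->
    (forall x y, P x -> P (x * free_gen K y)) ->
  forall x, P x.
Proof.
move=> P0 P1 PD PM; apply: malg_ind => // w.
have [s] := ubnP (size w); elim: s w => // s IHs [w].
case/lastP: w => [|w y]; first by rewrite -fmoneE.
rewrite size_rcons => ltws.
have -> : << FMonom (rcons w y) >> =
    (<< FMonom w >> : free_alg K X) * free_gen K y.
  by rewrite malgM_def fgmulUU mulr1 /free_gen fmuE [mmul _ _]fmmulE cats1.
by apply: PM; apply: IHs.
Qed.

(** * The group G(r,1,n) *)

(** A transposition of i < j is the conjugate of that of i and j - 1 by the
    simple transposition of j - 1 and j. *)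
Lemma adjacent_tperm_ind n (P : 'S_n -> Prop) :
    P 1%g -> (forall s t, P s -> P t -> P (s * t)%g) ->
    (forall i j : 'I_n, j = i.+1 :> nat -> P (tperm i j)) ->
  forall s, P s.
Proof.
move=> Pid Pmul Padj.
have Plt (d : nat) (i j : 'I_n) : j = (i + d).+1%N :> nat -> P (tperm i j).
  elim: d j => [|d IHd] j jE; first by apply: Padj; rewrite jE addn0.
  have lt_k : ((i + d).+1 < n)%N.
    by rewrite (leq_trans _ (ltn_ord j)) ?jE ?addnS.
  pose k := Ordinal lt_k.
  have kj : j = k.+1 :> nat by rewrite jE addnS.
  have -> : tperm i j = (tperm i k ^ tperm k j)%g.
    rewrite tpermJ tpermD ?tpermL //; apply/eqP => /(congr1 val) /=.
      by move/eqP; rewrite eqn_leq ltnNge leq_addr.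
    by rewrite jE; lia.
  rewrite /conjg tpermV; apply: (Pmul _ _); first exact: Padj.
  by apply: Pmul; [exact: IHd | exact: Padj].
move=> s; have [ts -> _] := prod_tpermP s.
elim: ts => [|[i j] ts IHts]; first by rewrite big_nil.
rewrite big_cons; apply: Pmul => //=.
have [ij|ji|/val_inj->] := ltngtP i j; last by rewrite tperm1.
  by apply: (Plt (j - i).-1%N); lia.
by rewrite tpermC; apply: (Plt (i - j).-1%N); lia.
Qed.

(** What the construction of the module uses about G(r,1,n): it keeps the
    computations with group elements apart from their realization by matrices.
    The order in [pwM] is due to the product of 'S_n, which composes from left
    to right. *)
Record Gr1n_data (r n : nat) (gT : groupType) (th : 'I_n -> gT)
    (pw : 'S_n -> gT) (pm : gT -> 'S_n) : Prop := {
  th_comm : forall i j, (th i * th j = th j * th i)%g;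
  th_expr : forall i, (th i ^+ r = 1)%g;
  pwM : forall s w, (pw s * pw w = pw (w * s))%g;
  pw1 : pw 1%g = 1%g;
  pw_th : forall w i, (pw w * th i = th (w i) * pw w)%g;
  pm1 : forall i, pm 1%g i = i;
  pmM : forall g h i, pm (g * h)%g i = pm g (pm h i);
  pm_th : forall i j, pm (th i) j = j;
  pm_pw : forall w i, pm (pw w) i = w i;
  Gr1n_ind : forall P : gT -> Prop, P 1%g ->
    (forall g i, P g -> P (g * th i)%g) ->
    (forall g (i j : 'I_n), j = i.+1 :> nat ->
      P g -> P (g * pw (tperm i j))%g) ->
    forall g, P g
}.

Section ReflectionGroupTheory.
Variables (C : numClosedFieldType) (r n : nat) (xi : C).
Hypothesis xiP : r.-primitive_root xi.
Local Notation G := (reflgrp n xiP).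
Local Notation th := (theta (n := n) xiP).
Local Notation pw := (wperm (n := n) xiP).

(** The nonzero entries of A are those of the permutation matrix of w. *)
Definition has_shape (A : 'M[C]_n) (w : 'S_n) :=
  forall i j, (A j i != 0) = (j == w i).

Lemma has_shape1 : has_shape 1%:M 1%g.
Proof. by move=> i j; rewrite perm1 mxE pnatr_eq0 eqb0 negbK. Qed.

Lemma has_shapeM A B w s :
  has_shape A w -> has_shape B s -> has_shape (A *m B) (s * w)%g.
Proof.
move=> Aw Bs i j; rewrite mxE (bigD1 (s i)) //= big1 => [|k ks].
  by rewrite addr0 mulf_eq0 negb_or Aw Bs eqxx andbT permM.
by apply/eqP; rewrite mulf_eq0 orbC -[B k i == 0]negbK Bs (negbTE ks).
Qed.

Lemma has_shapeV (A : unitary C n) w :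
  has_shape A w -> has_shape (invmx A) w^-1%g.
Proof.
move=> Aw i j; rewrite invmx_unitary ?unitary_mxP // !mxE fmorph_eq0 Aw.
by rewrite eq_sym (can2_eq (permK w) (permKV w)).
Qed.

Lemma has_shape_uniq A w s : has_shape A w -> has_shape A s -> w = s.
Proof. by move=> Aw As; apply/permP => i; apply/eqP; rewrite -As Aw. Qed.

Lemma has_shape_wperm w : has_shape (wperm_mx C w) w.
Proof. by move=> i j; rewrite mxE pnatr_eq0 eqb0 negbK. Qed.

Lemma has_shape_theta i : has_shape (theta_mx xi i) 1%g.
Proof.
have xi0 : xi != 0.
  apply: contra_eq_neq (prim_expr_order xiP) => ->.
  by rewrite expr0n gtn_eqF ?(prim_order_gt0 xiP) // eq_sym oner_neq0.
move=> j k; rewrite !mxE perm1; have [->|] := eqVneq k j; last by rewrite eqxx.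
by case: ifP; rewrite ?oner_eq0.
Qed.

Lemma has_shape_torus t : torus xiP t -> has_shape t 1%g.
Proof.
move=> Tt; apply: (Tt (fun t => has_shape t 1%g)); split; first split.
- exact: has_shape1.
- by move=> x y sx sy; rewrite -[1%g]mulg1; apply: has_shapeM.
- by move=> x sx; rewrite -[1%g]invg1; apply: has_shapeV.
- by move=> _ [i _ <-]; exact: has_shape_theta.
Qed.

Lemma refl_group_shape (g : G) : exists w, has_shape g w.
Proof.
case: g => _ /= /asboolP [t [w [Tt ->]]]; exists w.
have := has_shapeM (has_shape_torus Tt) (has_shape_wperm w).
by rewrite mulg1.
Qed.

Definition perm_part (g : G) : 'S_n := sval (cid (refl_group_shape g)).
Local Notation pm := perm_part.

Lemma perm_partP (g : G) : has_shape g (pm g).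
Proof. exact: svalP (cid (refl_group_shape g)). Qed.

Lemma perm_part1 i : pm 1%g i = i.
Proof.
by rewrite (has_shape_uniq (perm_partP 1%g) has_shape1) perm1.
Qed.

Lemma perm_partM (g h : G) i : pm (g * h)%g i = pm g (pm h i).
Proof.
have -> : pm (g * h)%g = (pm h * pm g)%g; last by rewrite permM.
apply: (has_shape_uniq (perm_partP _)).
exact: has_shapeM (perm_partP g) (perm_partP h).
Qed.

Lemma perm_part_theta i j : pm (th i) j = j.
Proof.
by rewrite (has_shape_uniq (perm_partP (th i)) (has_shape_theta i)) perm1.
Qed.

Lemma perm_part_wperm w i : pm (pw w) i = w i.
Proof. by rewrite (has_shape_uniq (perm_partP (pw w)) (has_shape_wperm w)). Qed.

Lemma theta_comm i j : (th i * th j = th j * th i)%g.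
Proof.
do 2 apply/val_inj => /=; rewrite /theta_mx !mulmx_diag.
by congr diag_mx; apply/rowP => k; rewrite !mxE mulrC.
Qed.

Lemma theta_expr i : (th i ^+ r = 1)%g.
Proof.
have thX m : val (val (th i ^+ m)%g) =
    diag_mx (\row_j (if j == i then xi ^+ m else 1)).
  elim: m => [|m IHm].
    rewrite expg0 /= -diag_const_mx; congr diag_mx.
    by apply/rowP => k; rewrite !mxE; case: ifP.
  rewrite expgSr /= IHm /= mulmx_diag; congr diag_mx; apply/rowP => k.
  by rewrite !mxE; case: ifP; rewrite ?mulr1 // exprSr.
do 2 apply/val_inj; rewrite thX (prim_expr_order xiP) /= -diag_const_mx.
by congr diag_mx; apply/rowP => k; rewrite !mxE; case: ifP.
Qed.

Lemma wpermM s w : (pw s * pw w = pw (w * s))%g.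
Proof. exact/val_inj/UpermM. Qed.

Lemma wperm_theta w i : (pw w * th i = th (w i) * pw w)%g.
Proof. exact/val_inj/Uperm_theta. Qed.

Lemma wperm1 : pw 1%g = 1%g.
Proof. exact/val_inj/Uperm1. Qed.

(** G is generated as a monoid by the theta_i and the simple transpositions: the
    inverse of theta_i is a power of it. *)
Lemma refl_group_ind (P : G -> Prop) :
    P 1%g -> (forall g i, P g -> P (g * th i)%g) ->
    (forall g (i j : 'I_n), j = i.+1 :> nat ->
      P g -> P (g * pw (tperm i j))%g) ->
  forall g, P g.
Proof.
move=> P1 Pth Ps; pose Q h := forall g, P g -> P (g * h)%g.
have Q1 : Q 1%g by move=> g; rewrite mulg1.
have QM h k : Q h -> Q k -> Q (h * k)%g.
  by move=> Qh Qk g Pg; rewrite mulgA; apply/Qk/Qh.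
have QX h m : Q h -> Q (h ^+ m)%g.
  by move=> Qh; elim: m => // m IHm; rewrite expgS; exact: QM.
have Qpw w : Q (pw w).
  elim/adjacent_tperm_ind: w => [|s t Qs Qt|i j ij g]; first by rewrite wperm1.
    by rewrite -wpermM; exact: QM.
  exact: Ps.
(* The torus is a generated subgroup, so inverses are carried along. *)
have Qtorus t : torus xiP t ->
    exists h, [/\ val h = t, Q h & Q h^-1%g].
  move=> Tt; apply: (Tt (fun t => exists h, [/\ val h = t, Q h & Q h^-1%g])).
  split; first split.
  - by exists 1%g; rewrite invg1.
  - move=> _ _ [h [<- Qh Qh']] [k [<- Qk Qk']]; exists (h * k)%g; split=> //.
      exact: QM.
    by rewrite invgM; exact: QM.
  - by move=> _ [h [<- Qh Qh']]; exists h^-1%g; rewrite invgK.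
  - move=> _ [i _ <-]; exists (th i); split=> //; first by move=> g; exact: Pth.
    have -> : ((th i)^-1 = th i ^+ r.-1)%g.
      apply: mulg1_eq; rewrite -expgS prednK ?theta_expr //.
      exact: prim_order_gt0 xiP.
    by apply: QX => g; exact: Pth.
move=> g; have [t [w [/Qtorus [h [ht Qh _]] gE]]] := asboolP _ (reflgrpP g).
have -> : g = (1 * h * pw w)%g.
  by apply/val_inj; rewrite mul1g /= gE -ht.
by apply: Qpw; apply: Qh.
Qed.

Lemma refl_group_data : Gr1n_data r th pw pm.
Proof.
split; [exact: theta_comm | exact: theta_expr | exact: wpermM | exact: wperm1 |
  exact: wperm_theta | exact: perm_part1 | exact: perm_partM |
  exact: perm_part_theta | exact: perm_part_wperm | exact: refl_group_ind].
Qed.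

End ReflectionGroupTheory.

(** * Reflections of G(r,1,n) *)

Lemma sum_shift (V : nmodType) (r : nat) (F : nat -> V) :
  F r = F 0%N -> \sum_(a < r) F a.+1 = \sum_(a < r) F a.
Proof.
case: r => [|r] Fr; first by rewrite !big_ord0.
by rewrite big_ord_recr [RHS]big_ord_recl /= Fr addrC.
Qed.

Lemma sum_cyclic_inv (V : nmodType) (gT : groupType) (x : gT) (r : nat)
    (F : gT -> V) :
  (x ^+ r = 1)%g -> \sum_(a < r) F (x^-1 ^+ a)%g = \sum_(a < r) F (x ^+ a)%g.
Proof.
move=> xr; pose F' a := F (x^-1 ^+ a)%g.
rewrite -[LHS](@sum_shift _ _ F'); last first.
  by rewrite /F' expgVn xr invg1.
rewrite (reindex_inj rev_ord_inj) /=; apply: eq_bigr => a _; congr F.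
rewrite expgVn; apply: mulg1_eq; rewrite -expgD -[RHS]xr; congr (_ ^+ _)%g.
by have := ltn_ord a; lia.
Qed.

Section Gr1nReflections.
Variables (r n : nat) (gT : groupType).
Variables (th : 'I_n -> gT) (pw : 'S_n -> gT) (pm : gT -> 'S_n).
Hypothesis GP : Gr1n_data r th pw pm.

Definition theta_quot i j : gT := (th i * (th j)^-1)%g.
Definition refl i j a : gT := (theta_quot i j ^+ a * pw (tperm i j))%g.

Lemma theta_commV i j : commute (th i) (th j)^-1%g.
Proof. by apply: commuteV; exact: (th_comm GP). Qed.

Lemma theta_quot_expr i j : (theta_quot i j ^+ r = 1)%g.
Proof.
rewrite /theta_quot expgMn; last exact: theta_commV.
by rewrite expgVn !(th_expr GP) invg1 mulg1.
Qed.

Lemma theta_quotE i j a : (theta_quot i j ^+ a = th i ^+ a * th j ^- a)%g.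
Proof.
by rewrite /theta_quot expgMn ?expgVn //; exact: theta_commV.
Qed.

Lemma theta_quotV i j : ((theta_quot i j)^-1 = theta_quot j i)%g.
Proof. by rewrite /theta_quot invgM invgK. Qed.

Lemma theta_quot_theta i j a c :
  (theta_quot i j ^+ a * th c = th c * theta_quot i j ^+ a)%g.
Proof.
apply/commute_sym/commuteX/commuteM; first exact: (th_comm GP).
exact: theta_commV.
Qed.

Lemma pw_theta_quot w i j :
  (pw w * theta_quot i j = theta_quot (w i) (w j) * pw w)%g.
Proof.
rewrite /theta_quot mulgA (pw_th GP) -!mulgA; congr (_ * _)%g.
apply: (mulIg (th j)); rewrite mulgKV -mulgA (pw_th GP) mulgA mulVg.
by rewrite mul1g.
Qed.

Lemma pw_theta_quotX w i j a :
  (pw w * theta_quot i j ^+ a = theta_quot (w i) (w j) ^+ a * pw w)%g.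
Proof.
elim: a => [|a IHa]; first by rewrite !expg0 mulg1 mul1g.
by rewrite !expgSr mulgA IHa -mulgA pw_theta_quot mulgA.
Qed.

Lemma pw_refl w i j a : (pw w * refl i j a = refl (w i) (w j) a * pw w)%g.
Proof.
rewrite /refl mulgA pw_theta_quotX -!mulgA !(pwM GP); congr (_ * pw _)%g.
by rewrite -tpermJ /conjg !mulgA mulgV mul1g.
Qed.

End Gr1nReflections.

(** * The module with basis [g; m] *)

(** Locked for the same reason as [malg_lin]. *)
HB.lock Definition malg_basis (K : nzRingType) (B : choiceType) (b : B) :
  {malg K[B]} := << b >>.

Lemma malg_lin_basis (K : nzRingType) (B : choiceType) (V : lmodType K)
  (phi : B -> V) b : malg_lin phi (malg_basis K b) = phi b.
Proof. by rewrite malg_basis.unlock malg_linU. Qed.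

(** This is 1 if the pair (j, i) with j < i is inverted by w, -1 if the pair
    (i, j) with i < j is, and 0 otherwise. *)
Definition inv_sign (K : nzRingType) (n : nat) (w : 'S_n) (i j : 'I_n) : K :=
  (j < i)%:R - (w j < w i)%:R.

Notation pbw_mod K n gT := {malg K[(gT * 'X_{1..n})%type]}.

HB.lock Definition act_t (K : nzRingType) (n : nat) (gT : groupType) (h : gT) :
    {linear pbw_mod K n gT -> pbw_mod K n gT} :=
  malg_lin (fun b : gT * 'X_{1..n} => malg_basis K ((b.1 * h)%g, b.2)).

(** The sum over a of the reflections [refl th pw i j a], multiplied by k0, is
    ktilde_ij s_ij. *)
HB.lock Definition act_e (K : nzRingType) (r n : nat) (gT : groupType)
    (th : 'I_n -> gT) (pw : 'S_n -> gT) (pm : gT -> 'S_n) (k0 : K) (i : 'I_n) :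
    {linear pbw_mod K n gT -> pbw_mod K n gT} :=
  malg_lin (fun b : gT * 'X_{1..n} =>
    malg_basis K (b.1, (b.2 + U_(pm b.1 i))%MM) +
    k0 *: \sum_j inv_sign K (pm b.1) i j *:
      \sum_(a < r) malg_basis K ((b.1 * refl th pw i j a)%g, b.2)).

(** The right multiplication by ktilde_ij; see [act_ktilde]. *)
HB.lock Definition act_k (K : nzRingType) (r n : nat) (gT : groupType)
    (th : 'I_n -> gT) (k0 : K) (i j : 'I_n) :
    {linear pbw_mod K n gT -> pbw_mod K n gT} :=
  malg_lin (fun b : gT * 'X_{1..n} =>
    k0 *: \sum_(a < r) malg_basis K ((b.1 * theta_quot th i j ^+ a)%g, b.2)).

Section HeckeModule.
Variables (C : numClosedFieldType) (r n : nat) (gT : groupType).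
Variables (th : 'I_n -> gT) (pw : 'S_n -> gT) (pm : gT -> 'S_n).
Hypothesis GP : Gr1n_data r th pw pm.
Variable k0 : C.
Local Notation M := {malg C[(gT * 'X_{1..n})%type]}.
Local Notation pbw g m := (malg_basis C (g : gT, m : 'X_{1..n})).
Local Notation refl := (refl th pw).
Local Notation theta_quot := (theta_quot th).
Local Notation aE := (@act_e C r n gT th pw pm k0).
Local Notation aT := (@act_t C n gT).
Local Notation aK := (@act_k C r n gT th k0).

Lemma act_eE i g m : aE i (pbw g m) = pbw g (m + U_(pm g i))%MM +
  k0 *: \sum_j inv_sign C (pm g) i j *: \sum_(a < r) pbw (g * refl i j a)%g m.
Proof. by rewrite act_e.unlock [LHS]malg_lin_basis. Qed.

Lemma act_e1 i m : aE i (pbw 1%g m) = pbw 1%g (m + U_(i))%MM.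
Proof.
rewrite act_eE (pm1 GP) big1 ?scaler0 ?addr0 // => j _.
by rewrite /inv_sign !(pm1 GP) subrr scale0r.
Qed.

Lemma act_tE h g m : aT h (pbw g m) = pbw (g * h)%g m.
Proof. by rewrite act_t.unlock [LHS]malg_lin_basis. Qed.

Lemma pbw_ext (f g : M -> M) : linear f -> linear g ->
  (forall h m, f (pbw h m) = g (pbw h m)) -> f =1 g.
Proof.
move=> flin glin fg; apply: malg_ind => [[h m]|a x y fx fy|].
- by have := fg h m; rewrite malg_basis.unlock.
- by rewrite flin glin fx fy.
- by rewrite !linear_map0.
Qed.

Lemma linear_comp (f g : {linear M -> M}) : linear (fun v => f (g v)).
Proof. by move=> a u v; rewrite !linearP. Qed.

Lemma act_tM g h v : aT h (aT g v) = aT (g * h)%g v.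
Proof.
move: v; apply: pbw_ext; [exact: linear_comp | exact: linearP|] => k m.
by rewrite !act_tE mulgA.
Qed.

Lemma act_t1 v : aT 1%g v = v.
Proof.
move: v; apply: pbw_ext; [exact: linearP | by [] |] => k m.
by rewrite act_tE mulg1.
Qed.

Lemma act_teE h i g m : aT h (aE i (pbw g m)) =
  pbw (g * h)%g (m + U_(pm g i))%MM + k0 *:
    \sum_j inv_sign C (pm g) i j *: \sum_(a < r) pbw (g * (refl i j a * h))%g m.
Proof.
rewrite act_eE linearD linearZ_LR [X in _ *: X]linear_sum act_tE.
congr (_ + _ *: _); apply: eq_bigr => j _; rewrite linearZ_LR linear_sum.
by congr (_ *: _); apply: eq_bigr => a _; rewrite act_tE -mulgA.
Qed.

(** The sum of the reflections theta_i^a theta_j^-a s_ij over a is not changed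
    when multiplied by theta_i rather than theta_j, since this only shifts a. *)
Lemma sum_refl_theta i j c (F : gT -> M) :
  \sum_(a < r) F (refl i j a * th c)%g =
  \sum_(a < r) F (th c * refl i j a)%g.
Proof.
pose S d := \sum_(a < r) F (th d * refl i j a)%g.
have Sij : S i = S j.
  rewrite /S -[RHS](@sum_shift _ r (fun a => F (th j * refl i j a)%g)).
    apply: eq_bigr => a _; congr F; rewrite /refl expgS /theta_quot.
    by rewrite !mulgA [(th j * th i)%g](th_comm GP) mulgK.
  by rewrite /refl (theta_quot_expr GP) expg0.
transitivity (S (tperm i j c)); last first.
  by rewrite -/(S c); case: tpermP => [->|->|].
apply: eq_bigr => a _; congr F.
by rewrite /refl -mulgA (pw_th GP) mulgA (theta_quot_theta GP) mulgA.
Qed.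

Lemma act_e_theta i c v : aE i (aT (th c) v) = aT (th c) (aE i v).
Proof.
move: v; apply: pbw_ext; [exact: linear_comp | exact: linear_comp |] => g m.
rewrite act_tE act_teE act_eE (pmM GP) (pm_th GP).
congr (_ + _ *: _); apply: eq_bigr => j _.
rewrite /inv_sign !(pmM GP) !(pm_th GP); congr (_ *: _).
rewrite (sum_refl_theta _ _ _ (fun x => pbw (g * x)%g m)).
by apply: eq_bigr => a _; rewrite -mulgA.
Qed.

Lemma act_kE i j v :
  aK i j v = k0 *: \sum_(a < r) aT (theta_quot i j ^+ a)%g v.
Proof.
move: v; apply: pbw_ext => [|a u v|g m]; first exact: linearP.
  rewrite scalerA (mulrC a) -scalerA -scalerDr; congr (_ *: _).
  by rewrite scaler_sumr -big_split; apply: eq_bigr => b _; rewrite linearP.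
rewrite act_k.unlock [LHS]malg_lin_basis; congr (_ *: _).
by apply: eq_bigr => a _; rewrite act_tE.
Qed.

Lemma act_kC i j : aK i j =1 aK j i.
Proof.
move=> v; rewrite !act_kE -theta_quotV; congr (_ *: _).
by rewrite (sum_cyclic_inv (fun x => aT x v)) // (theta_quot_expr GP).
Qed.

Lemma act_t_commute i g h :
    (forall v, aE i (aT g v) = aT g (aE i v)) ->
    (forall v, aE i (aT h v) = aT h (aE i v)) ->
  forall v, aE i (aT (g * h)%g v) = aT (g * h)%g (aE i v).
Proof. by move=> eg eh v; rewrite -!act_tM eh eg. Qed.

Lemma act_e_theta_quot i j l a v :
  aE i (aT (theta_quot j l ^+ a)%g v) =
  aT (theta_quot j l ^+ a)%g (aE i v).
Proof.
have thV c u : aE i (aT (th c)^-1%g u) = aT (th c)^-1%g (aE i u).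
  rewrite -[in RHS](act_t1 u) -(mulVg (th c)) -act_tM act_e_theta act_tM.
  by rewrite mulgV act_t1.
elim: a v => [|a IHa] v; first by rewrite expg0 !act_t1.
rewrite expgS; apply: (act_t_commute _ IHa) => u.
by apply: act_t_commute => w; [exact: act_e_theta | exact: thV].
Qed.

Lemma act_e_k i j l v : aE i (aK j l v) = aK j l (aE i v).
Proof.
rewrite !act_kE linearZ_LR linear_sum; congr (_ *: _).
by apply: eq_bigr => a _; rewrite act_e_theta_quot.
Qed.

Section AdjacentTransposition.
Variables (p q : 'I_n).
Hypothesis pq : q = p.+1 :> nat.
Local Notation s := (tperm p q).

(** For the simple transposition s of p and q = p + 1, the sign of the term in
    ktilde in the straightening of t_s e_i. *)
Definition jump (i : 'I_n) : C := (i == q)%:R - (i == p)%:R.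

(** Apart from p and q, no two indices are put in the other order by s; this
    single exception produces the term in ktilde. *)
Lemma jumpP (i j : 'I_n) :
  (s j < i)%:R - (j < s i)%:R = jump i *+ (j == i) :> C.
Proof.
have key :
    ((s j < i) + (j == i) * (i == p) = (j < s i) + (j == i) * (i == q))%N.
  case: tpermP => [->|->|/eqP + /eqP]; case: tpermP => [->|->|/eqP + /eqP];
    rewrite -?val_eqE /=; lia.
rewrite /jump; move: key; case: (j == i); rewrite ?mul0n ?addn0 ?mul1n => key.
  apply/eqP; rewrite subr_eq addrAC eq_sym subr_eq -!natrD eqr_nat.
  by rewrite key addnC.
by rewrite key subrr.
Qed.

(** For i = p this is the last defining relation, for i = q its conjugate by
    t_s, and for the other i the commutation of t_s and e_i. *)
Lemma act_e_adj i v : aE i (aT (pw s) v) =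
  aT (pw s) (aE (s i) v) + jump i *: aK p q v.
Proof.
move: v; apply: pbw_ext => [|a u v|g m]; first exact: linear_comp.
  rewrite !(linearP (aE _)) !(linearP (aT _)) !(linearP (aK _ _)).
  by rewrite !scalerDr addrACA scalerA (mulrC _ a) -scalerA.
pose S j := \sum_(a < r) pbw (g * (refl (s i) j a * pw s))%g m.
(* Rewrite the term in ktilde as a sum over j supported at j = i. *)
have -> : jump i *: aK p q (pbw g m) =
    k0 *: \sum_j (jump i *+ (j == i)) *: S j.
  rewrite (bigD1 i) //= [X in _ + X]big1 ?addr0; last first.
    by move=> j /negbTE ->; rewrite scale0r.
  rewrite eqxx mulr1n scalerA (mulrC k0) -scalerA.
  have [ij|] := boolP ((i == p) || (i == q)); last first.
    rewrite negb_or /jump => /andP[/negbTE-> /negbTE->].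
    by rewrite subrr !scale0r.
  have SE : k0 *: S i = aK (s i) i (pbw g m).
    rewrite act_kE; congr (_ *: _); apply: eq_bigr => a _.
    rewrite /refl; have -> : tperm (s i) i = s.
      by case/orP: ij => /eqP ->; rewrite ?tpermL ?tpermR // tpermC.
    by rewrite -!mulgA (pwM GP) tperm2 (pw1 GP) mulg1 act_tE.
  rewrite SE; case/orP: ij => /eqP ->; last by rewrite tpermR.
  by rewrite tpermL act_kC.
rewrite act_tE act_teE act_eE (pmM GP) (pm_pw GP).
rewrite -addrA -scalerDr -big_split; congr (_ + _ *: _).
rewrite (reindex_inj (@perm_inj _ s)); apply: eq_bigr => j _ /=.
rewrite -[RHS]scalerDl -jumpP; congr (_ *: _).
  rewrite /inv_sign !(pmM GP) !(pm_pw GP) tpermK.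
  by rewrite [RHS]addrC addrA subrK.
by apply: eq_bigr => a _; rewrite -mulgA (pw_refl GP) tpermK.
Qed.

(** The terms in ktilde cancel when e_i and e_j are exchanged. *)
Lemma jump_balance (F : 'I_n -> M) i j :
  jump j *: F (s i) + jump i *: F j = jump i *: F (s j) + jump j *: F i.
Proof.
have neq_pq : (p == q) = false by rewrite -val_eqE /=; lia.
have neq_qp : (q == p) = false by rewrite eq_sym.
rewrite /jump; case: tpermP => [->|->|/eqP/negbTE ip /eqP/negbTE iq];
  case: tpermP => [->|->|/eqP/negbTE jp /eqP/negbTE jq];
  rewrite ?eqxx ?neq_pq ?neq_qp ?ip ?iq ?jp ?jq ?subrr ?sub0r ?subr0;
  rewrite ?scale0r ?add0r ?addr0 ?scale1r ?scaleN1r //;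
  by rewrite subrr addNr.
Qed.

(** Moving t_s across two operators e_i, e_j turns their commutator into that of
    e_(si), e_(sj), the two terms with a single e being balanced. *)
Lemma act_eC_adj i j v :
    (forall i j, aE j (aE i v) = aE i (aE j v)) ->
  aE j (aE i (aT (pw s) v)) = aE i (aE j (aT (pw s) v)).
Proof.
move=> ev; have two k l : aE l (aE k (aT (pw s) v)) =
    aT (pw s) (aE (s l) (aE (s k) v)) +
    (jump l *: aK p q (aE (s k) v) + jump k *: aK p q (aE l v)).
  rewrite act_e_adj (linearD (aE l)) (linearZ_LR (aE l)) act_e_k act_e_adj.
  by rewrite -addrA.
rewrite (two i j) (two j i) (ev (s i) (s j)).
by rewrite (jump_balance (fun k => aK p q (aE k v))).
Qed.
End AdjacentTransposition.

Lemma act_eC i j v : aE j (aE i v) = aE i (aE j v).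
Proof.
move: v; apply: pbw_ext => [||g m]; [exact: linear_comp | exact: linear_comp |].
elim/(Gr1n_ind GP): g i j m => [|g c IHg|g p q pq IHg] i j m.
- by rewrite !act_e1 -!addmA [(U_(i) + _)%MM]addmC.
- by rewrite -act_tE !act_e_theta IHg.
- by rewrite -act_tE; apply: act_eC_adj => // k l; exact: IHg.
Qed.

(** In ktilde the second half of the sum is the first half in the reverse order,
    whence the factor 2. *)
Lemma act_ktilde i j v :
  malg_lin (fun h => aT h v) ((k0 / 2%:R) *: \sum_(a < r)
    (<< (th i ^+ a * th j ^- a)%g >> + << (th j ^+ a * th i ^- a)%g >>)) =
  aK i j v.
Proof.
rewrite linearZ_LR linear_sum.
under eq_bigr => a _ do
  rewrite linearD /= !malg_linU -!(theta_quotE GP).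
rewrite big_split /= -[theta_quot j i]theta_quotV.
rewrite (sum_cyclic_inv (fun x => aT x v)) ?(theta_quot_expr GP) //.
by rewrite scalerDr -scalerDl -splitr act_kE.
Qed.

End HeckeModule.

(** * The action of the algebra on the module *)

Section HeckeRepresentation.
Variables (C : numClosedFieldType) (r n : nat) (xi : C).
Hypothesis xiP : r.-primitive_root xi.
Variable k0 : C.
Local Notation G := (reflgrp n xiP).
Local Notation th := (theta (n := n) xiP).
Local Notation pw := (wperm (n := n) xiP).
Local Notation pm := (perm_part (xiP := xiP)).
Local Notation M := {malg C[(G * 'X_{1..n})%type]}.
Local Notation pbw g m := (malg_basis C (g : G, m : 'X_{1..n})).
Local Notation H := (hecke n xiP k0).
Local Notation X := ('I_n + G)%type.

Let GP : Gr1n_data r th pw pm := refl_group_data n xiP.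

Definition gen_act (y : X) : {linear M -> M} :=
  match y with
  | inl i => act_e r th pw pm k0 i
  | inr g => act_t C n g
  end.

Lemma act_Fe v i : free_act gen_act v (Fe xiP i) = act_e r th pw pm k0 i v.
Proof. exact: free_act_gen. Qed.

Lemma act_Ft v g : free_act gen_act v (Ft g) = act_t C n g v.
Proof. exact: free_act_gen. Qed.

Lemma act_Ft_lin v (x : group_alg n xiP) :
  free_act gen_act v (Ft_lin x) = malg_lin (fun h => act_t C n h v) x.
Proof.
rewrite malg_lin.unlock linear_sum; apply: eq_bigr => g _.
by rewrite linearZ_LR act_Ft.
Qed.

Lemma act_hecke_rel x v : hecke_rel k0 x -> free_act gen_act v x = 0.
Proof.
have actB y z : free_act gen_act v y = free_act gen_act v z ->
    free_act gen_act v (y - z) = 0.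
  by move=> yz; rewrite (linearB (free_act gen_act v)) yz subrr.
have act2 a b : free_act gen_act v (free_gen C a * free_gen C b) =
    gen_act b (gen_act a v).
  by rewrite free_actM !free_act_gen.
(* The generators are named explicitly: unification cannot find them fast, since
   it unfolds elements of the free algebra. *)
case=> [i j|g h||i j|i j j' jj' ij ij'|i i' ii']; apply: actB.
- apply: (etrans (act2 (inl i) (inl j))).
  apply: (etrans _ (esym (act2 (inl j) (inl i)))).
  exact: act_eC GP k0 _ _ _.
- apply: (etrans (act2 (inr g) (inr h))).
  by rewrite [RHS](free_act_gen _ (inr (g * h)%g)) /gen_act act_tM.
- by rewrite [LHS](free_act_gen _ (inr 1%g)) free_act1 /gen_act act_t1.
- apply: (etrans (act2 (inr (th i)) (inl j))).
  apply: (etrans _ (esym (act2 (inl j) (inr (th i))))).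
  exact: act_e_theta GP k0 _ _ _.
- apply: (etrans (act2 (inr (pw (tperm j j'))) (inl i))).
  apply: (etrans _ (esym (act2 (inl i) (inr (pw (tperm j j')))))).
  rewrite /gen_act (act_e_adj GP k0 jj').
  rewrite /jump (negbTE ij) (negbTE ij') subrr scale0r.
  by rewrite tpermD ?addr0 // eq_sym.
- rewrite (linearB (free_act gen_act v)) act_Ft_lin.
  apply: (etrans (act2 (inr (pw (tperm i i'))) (inl i))).
  rewrite [X in _ = X - _](act2 (inl i') (inr (pw (tperm i i')))).
  rewrite /gen_act (act_e_adj GP k0 ii') tpermL (act_ktilde GP) /jump eqxx.
  have /negbTE-> : i != i' by rewrite -val_eqE /= ii'; lia.
  by rewrite sub0r scaleN1r.
Qed.

Lemma hecke_rep : exists rho : {linear H -> M},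
  forall x, rho (presented_pi (hecke_rel k0) x) =
    free_act gen_act (pbw 1%g 0%MM) x.
Proof. by apply: presented_act => x relx v; exact: act_hecke_rel. Qed.

End HeckeRepresentation.

(** * Straightening in the algebra *)

Lemma comm_prod_incr (R : pzSemiRingType) (I : eqType) (e : I -> R)
    (k : I -> nat) (j : I) (s : seq I) :
  (forall i, GRing.comm (e j) (e i)) ->
  \prod_(i <- s) e i ^+ (k i + (j == i)) =
  \prod_(i <- s) e i ^+ k i * e j ^+ count_mem j s.
Proof.
move=> ej; elim: s => [|i s IHs] /=; first by rewrite !big_nil mulr1.
rewrite !big_cons IHs exprD [i == j]eq_sym exprD -!mulrA; congr (_ * _).
rewrite !mulrA; congr (_ * _); have [<-|_] := eqVneq j i; last first.
  by rewrite !expr0 mul1r mulr1.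
by rewrite expr1; apply: commr_prod => l _; apply: commrX.
Qed.

(** Preimages chosen on basis vectors extend by linearity. *)
Lemma malg_image (K : nzRingType) (B : choiceType) (U V W : lmodType K)
    (f : {linear {malg K[B]} -> V}) (g : {linear U -> W}) (L : V -> W) :
    linear L -> (forall b, exists u, L (f << b >>) = g u) ->
  forall x, exists u, L (f x) = g u.
Proof.
move=> linL Lf; elim/malg_ind => [//|a x y [u Eu] [v Ev]|].
  by exists (a *: u + v); rewrite !linearP linL Eu Ev.
by exists 0; rewrite !linear0 (linear_map0 linL).
Qed.

Lemma involution_swap (R : pzRingType) (s a b k : R) :
  s * s = 1 -> s * a = b * s - k -> s * b = a * s + s * (k * s).
Proof.
move=> ss sa; have -> : k = b * s - s * a by rewrite sa opprB addrC subrK.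
rewrite mulrBl mulrBr -[b * s * s]mulrA ss mulr1 -[s * a * s]mulrA.
by rewrite [s * (s * _)]mulrA ss mul1r addrC subrK.
Qed.

Lemma straightenM (R : pzRingType) (a b x y z c d : R) :
    b * x = y * b + c -> a * y = z * a + d ->
  a * b * x = z * (a * b) + (d * b + a * c).
Proof.
by move=> bx ay; rewrite -mulrA bx mulrDr mulrA ay mulrDl -mulrA addrA.
Qed.

Lemma straighten_mull (R : pzRingType) (x a y z c : R) :
  a * y = z * a + c -> x * a * y = x * z * a + x * c.
Proof. by move=> ay; rewrite -mulrA ay mulrDr mulrA. Qed.

Section HeckeBasis.
Variables (C : numClosedFieldType) (r n : nat) (xi : C).
Hypothesis xiP : r.-primitive_root xi.
Variable k0 : C.
Local Notation G := (reflgrp n xiP).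
Local Notation th := (theta (n := n) xiP).
Local Notation pw := (wperm (n := n) xiP).
Local Notation M := {malg C[(G * 'X_{1..n})%type]}.
Local Notation pbw g m := (malg_basis C (g : G, m : 'X_{1..n})).
Local Notation H := (hecke n xiP k0).
Local Notation rel := (@hecke_rel C r n xi xiP k0).
Local Notation piH := (presented_pi rel).
Local Notation e := (@hecke_e C r n xi xiP k0).
Local Notation t := (@hecke_t C r n xi xiP k0).

Let GP : Gr1n_data r th pw (@perm_part C r n xi xiP) := refl_group_data n xiP.

Lemma hecke_relP x y : rel (x - y) -> piH x = piH y.
Proof. by move=> xy; apply/presented_piP => S [_]; exact. Qed.

Lemma hecke_eC i j : e i * e j = e j * e i.
Proof.
rewrite -!(rmorphM piH).
by apply: hecke_relP; exact: rel_comm.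
Qed.

Lemma hecke_tM g h : t g * t h = t (g * h)%g.
Proof.
rewrite -(rmorphM piH).
by apply: hecke_relP; exact: rel_group.
Qed.

Lemma hecke_t1 : t 1%g = 1.
Proof.
rewrite -(rmorph1 piH).
by apply: hecke_relP; exact: rel_one.
Qed.

Lemma hecke_theta_e i j : t (th i) * e j = e j * t (th i).
Proof.
rewrite -!(rmorphM piH).
by apply: hecke_relP; exact: rel_theta.
Qed.

Lemma hecke_far (i p q : 'I_n) : q = p.+1 :> nat -> i != p -> i != q ->
  t (pw (tperm p q)) * e i = e i * t (pw (tperm p q)).
Proof.
move=> pq ip iq; rewrite -!(rmorphM piH).
by apply: hecke_relP; exact: rel_far.
Qed.

Fact t_lin_key : unit. Proof. exact: tt. Qed.
(** Locked to keep rewriting from unfolding it. *)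
Definition t_lin : {linear group_alg n xiP -> H} :=
  locked_with t_lin_key (malg_lin (t : G -> H) : {linear group_alg n xiP -> H}).

Lemma t_linE g : t_lin (group_gen g) = t g.
Proof. by rewrite /t_lin unlock [LHS]malg_linU. Qed.

Lemma t_linU (g : G) : t_lin << g >> = t g.
Proof. exact: t_linE. Qed.

Lemma hecke_adj (p q : 'I_n) : q = p.+1 :> nat ->
  t (pw (tperm p q)) * e p =
  e q * t (pw (tperm p q)) - t_lin (ktilde xiP k0 p q).
Proof.
move=> pq.
have -> : t_lin (ktilde xiP k0 p q) =
    piH (Ft_lin (ktilde xiP k0 p q)).
  rewrite /t_lin unlock /= malg_lin.unlock /Ft_lin (linear_sum piH).
  by apply: eq_bigr => g _; rewrite linearZ_LR.
rewrite -!(rmorphM piH) -linearB.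
by apply: hecke_relP; exact: rel_adj.
Qed.

Definition hecke_mono (m : 'X_{1..n}) : H := \prod_(i < n) e i ^+ m i.

Lemma hecke_monoM m j : hecke_mono m * e j = hecke_mono (m + U_(j))%MM.
Proof.
rewrite /hecke_mono; under [RHS]eq_bigr => i _ do rewrite mnmDE mnm1E.
rewrite comm_prod_incr; last by move=> i; exact: hecke_eC.
have -> : count_mem j (index_enum 'I_n) = 1%N.
  by rewrite count_uniq_mem ?index_enum_uniq // mem_index_enum.
by rewrite expr1.
Qed.

Definition pbw_map : {linear M -> H} :=
  malg_lin (fun b : G * 'X_{1..n} => hecke_mono b.2 * t b.1).

Lemma pbw_mapE g m : pbw_map (pbw g m) = hecke_mono m * t g.
Proof. exact: malg_lin_basis. Qed.

Lemma hecke_mull_linear (x : H) : linear (fun y : H => x * y).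
Proof. by move=> a y z; rewrite mulrDr -presented_scalerAr. Qed.

Lemma hecke_mulr_linear (x : H) : linear (fun y : H => y * x).
Proof. by move=> a y z; rewrite mulrDl -presented_scalerAl. Qed.

Lemma t_lin_mull g c : exists c', t g * t_lin c = t_lin c'.
Proof.
apply: (malg_image (hecke_mull_linear (t g))) => h.
by exists (group_gen (g * h)%g); rewrite [RHS]t_linE (t_linU h) hecke_tM.
Qed.

Lemma t_lin_mulr c g : exists c', t_lin c * t g = t_lin c'.
Proof.
move: c; apply: (malg_image (hecke_mulr_linear (t g))) => h.
by exists (group_gen (h * g)%g); rewrite [RHS]t_linE (t_linU h) hecke_tM.
Qed.

(** The relation gives the case i = p; that of i = p + 1 follows by multiplying
    the relation by t_s on both sides ([involution_swap]). *)
Lemma hecke_simple_e (p q i : 'I_n) : q = p.+1 :> nat ->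
  exists j c, t (pw (tperm p q)) * e i = e j * t (pw (tperm p q)) + t_lin c.
Proof.
move=> pq; have [->|ip] := eqVneq i p.
  by exists q, (- ktilde xiP k0 p q); rewrite (hecke_adj pq) linearN.
have [->|iq] := eqVneq i q; last first.
  by exists i, 0; rewrite (hecke_far pq ip iq) linear0 addr0.
set s := pw _; have ss : t s * t s = 1.
  by rewrite hecke_tM (pwM GP) tperm2 (pw1 GP) hecke_t1.
have [c1 Ec1] := t_lin_mulr (ktilde xiP k0 p q) s.
have [c Ec] := t_lin_mull s c1.
exists p, c; rewrite -Ec -Ec1; apply: involution_swap => //.
exact: hecke_adj.
Qed.

Lemma hecke_te g i : exists j c, t g * e i = e j * t g + t_lin c.
Proof.
elim/(Gr1n_ind GP): g i => [|g l IHg|g p q pq IHg] i.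
- by exists i, 0; rewrite hecke_t1 mul1r mulr1 linear0 addr0.
- have [j [c Ec]] := IHg i; have [c' Ec'] := t_lin_mulr c (th l).
  exists j, c'; rewrite -hecke_tM -Ec'.
  have th_e : t (th l) * e i = e i * t (th l) + 0.
    by rewrite [RHS]addr0; exact: hecke_theta_e.
  by apply: (etrans (straightenM th_e Ec)); rewrite mulr0 [X in _ + X]addr0.
- have [i' [c Ec]] := hecke_simple_e i pq; have [j [d Ed]] := IHg i'.
  have [c' Ec'] := t_lin_mull g c.
  have [d' Ed'] := t_lin_mulr d (pw (tperm p q)).
  exists j, (d' + c'); rewrite -hecke_tM (linearD t_lin) -Ec' -Ed'.
  exact: straightenM Ec Ed.
Qed.

(** The image of [pbw_map] contains 1 and is stable under right multiplication
    by the generators. *)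
Lemma pbw_map_surj x : exists v, pbw_map v = x.
Proof.
have [y <-] := presented_pi_surj x.
elim/free_alg_ind: y => [||a y z [u Eu] [v Ev]|y b [v Ev]].
- by exists 0; rewrite !linear0.
- exists (pbw 1%g 0%MM); rewrite pbw_mapE hecke_t1 mulr1 rmorph1.
  by apply: big1 => i _; rewrite mnm0E expr0.
- by exists (a *: u + v); rewrite linearP Eu Ev linearP.
have [|u Eu] := malg_image (f := pbw_map) (g := pbw_map)
    (hecke_mulr_linear (piH (free_gen C b))) _ v; last first.
  by exists u; rewrite -Eu Ev (rmorphM piH).
move=> [g m]; have -> : pbw_map << (g, m) >> = hecke_mono m * t g.
  by rewrite /pbw_map [LHS]malg_linU.
case: b => [i|h]; last first.
  by exists (pbw (g * h)%g m); rewrite pbw_mapE -hecke_tM mulrA.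
have [j [c Ec]] := hecke_te g i.
have [|v' Ev'] := malg_image (f := t_lin) (g := pbw_map)
    (hecke_mull_linear (hecke_mono m)) _ c.
  by move=> h; exists (pbw h m); rewrite pbw_mapE t_linU.
exists (pbw g (m + U_(j))%MM + v').
rewrite (linearD pbw_map) pbw_mapE -hecke_monoM -Ev'.
exact: straighten_mull Ec.
Qed.

Lemma act_mono v s (k : 'I_n -> nat) :
  free_act (gen_act k0) (pbw 1%g v) (\prod_(i <- s) Fe xiP i ^+ k i) =
  pbw 1%g (v + \sum_(i <- s) U_(i) *+ k i)%MM.
Proof.
elim: s v => [|i s IHs] v; first by rewrite !big_nil free_act1 addm0.
rewrite !big_cons free_actM addmA -IHs; congr (free_act _ _ _).
elim: (k i) => [|d IHd]; first by rewrite expr0 free_act1 mulm0n addm0.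
rewrite exprSr free_actM IHd act_Fe (act_e1 GP).
by rewrite -addmA mulmSr.
Qed.

(** No correction arises in the computation of [1; 0] e^m t_g, because all e_i
    act before t_g. *)
Lemma hecke_repK (rho : {linear H -> M}) :
    (forall x, rho (piH x) = free_act (gen_act k0) (pbw 1%g 0%MM) x) ->
  cancel pbw_map rho.
Proof.
move=> rhoE; apply: (pbw_ext (f := fun v => rho (pbw_map v))) => [a u v|//|g m].
  by rewrite (linearP pbw_map) (linearP rho).
rewrite pbw_mapE.
have -> : hecke_mono m * t g = piH ((\prod_(i < n) Fe xiP i ^+ m i) * Ft g).
  rewrite (rmorphM piH) (rmorph_prod piH); congr (_ * _).
  by apply: eq_bigr => i _; rewrite (rmorphXn piH).
by rewrite rhoE free_actM act_mono act_Ft act_tE mul1g add0m -multinomUE_id.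
Qed.

End HeckeBasis.

(** * Comparison with the tensor product *)

Section TensorBasis.
Variables (C : numClosedFieldType) (r n : nat) (xi : C).
Hypothesis xiP : r.-primitive_root xi.
Variable k0 : C.
Local Notation G := (reflgrp n xiP).
Local Notation M := {malg C[(G * 'X_{1..n})%type]}.
Local Notation H := (hecke n xiP k0).
Local Notation T := (tensor (mpoly n C) (group_alg n xiP)).
Local Notation t_lin := (@t_lin C r n xi xiP k0).

Lemma hecke_poly_linear : linear (hecke_poly xiP k0 : mpoly n C -> H).
Proof.
apply: supported_sum_linear => [p|p m|a m p q]; first exact: msupp_uniq.
  exact: memN_msupp_eq0.
by rewrite mcoeffD mcoeffZ.
Qed.

Lemma hecke_polyX (m : 'X_{1..n}) :
  hecke_poly xiP k0 'X_[m] = hecke_mono xiP k0 m.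
Proof. by rewrite /hecke_poly msuppX big_seq1 mcoeffX eqxx scale1r. Qed.

Definition tensor_basis : {linear M -> T} :=
  malg_lin (fun b : G * 'X_{1..n} =>
    tens ('X_[b.2] : mpoly n C) (group_gen b.1)).

Lemma tensor_basis_surj (y : T) : exists v, tensor_basis v = y.
Proof.
elim/tensor_ind: y => [p x|a y z [u <-] [v <-]|]; last first.
- by exists 0; rewrite linear0.
- by exists (a *: u + v); rewrite linearP.
have X_surj m : exists v, tens ('X_[m] : mpoly n C) x = tensor_basis v.
  move: x; apply: (@malg_image C G M (group_alg n xiP) T idfun tensor_basis
    (tens ('X_[m] : mpoly n C)) (tens_linearr _)) => g.
  by exists << (g, m) >>; rewrite [RHS]malg_linU.
elim/mpolyind: p => [|c m p _ _ [v Ev]].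
  by exists 0; rewrite linear0 (linear_map0 (tens_linearl x)).
have [u Eu] := X_surj m.
by exists (c *: u + v); rewrite tens_linearl Eu -Ev linearP.
Qed.

Lemma pbw_tensor_map : exists f : {linear T -> H},
  (forall p g, f (tens p (group_gen g)) = hecke_poly xiP k0 p * hecke_t k0 g) /\
  forall v, f (tensor_basis v) = pbw_map n xiP k0 v.
Proof.
have Bl x : linear (fun p : mpoly n C => hecke_poly xiP k0 p * t_lin x).
  move=> a p q; rewrite hecke_poly_linear; exact: hecke_mulr_linear.
have Br p : linear (fun x : group_alg n xiP => hecke_poly xiP k0 p * t_lin x).
  by move=> a x y; rewrite (linearP t_lin); exact: hecke_mull_linear.
have [f fE] := tensor_lift Bl Br.
have fg p g : f (tens p (group_gen g)) = hecke_poly xiP k0 p * hecke_t k0 g.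
  by rewrite fE t_linE.
exists f; split=> // v.
pose f' : {linear M -> H} := f \o tensor_basis.
apply: (linear_malg_ext (f := f')) => -[g m].
by rewrite /f' /= [X in f X]malg_linU [RHS]malg_linU fg hecke_polyX.
Qed.

End TensorBasis.

Theorem proposition2p1 (R : realType) (r n : nat)
  (r_ge1 : (1 <= r)%N) (n_ge1 : (1 <= n)%N)
  (xi k0 : R[i]) (xiP : r.-primitive_root xi) :
  exists f : {linear tensor (mpoly n R[i]) (group_alg n xiP) -> hecke n xiP k0},
    (forall (p : (mpoly n R[i])) (g : reflgrp n xiP),
       f (tens p (group_gen g)) = hecke_poly xiP k0 p * hecke_t k0 g) /\
    bijective f.
Proof.
have [f [fE f_pbw]] := pbw_tensor_map n xiP k0.
exists f; split=> //.
have [rho rhoE] := hecke_rep n xiP k0.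
have rhoK := hecke_repK rhoE.
exists (fun x => tensor_basis n xiP (rho x)) => [y|x].
  by have [v <-] := tensor_basis_surj y; rewrite f_pbw rhoK.
by have [v <-] := pbw_map_surj x; rewrite rhoK f_pbw.
Qed.
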